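(* Let $0<q<1$ and let $w,z\in\mathbb{C}$ with $wq^k\neq1$ for all integers $k\ge1$. Then $$A_q(wz)=(wq;q)_\infty\sum_{n=0}^\infty\frac{q^{n^2}w^n}{(wq;q)_n}\,S_n(zq^{-n};q).$$
   Context: Notation: $(c;q)_n=\prod_{j=0}^{n-1}(1-cq^j)$, $(c;q)_\infty=\prod_{j\ge0}(1-cq^j)$, $\genfrac{[}{]}{0pt}{}{n}{k}_q=\frac{(q;q)_n}{(q;q)_k(q;q)_{n-k}}$. The Ramanujan function is $A_q(z)=\sum_{n=0}^\infty\frac{(-z)^n}{(q;q)_n}q^{n^2}$. The Stieltjes–Wigert polynomials are $S_n(x;q)=\frac{1}{(q;q)_n}\sum_{k=0}^n\genfrac{[}{]}{0pt}{}{n}{k}_q q^{k^2}(-x)^k$. *)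

(* Defs.v *)
From Stdlib Require Export Reals.
From Coquelicot Require Export Coquelicot.

Open Scope C_scope.

(* Convergence and limits in C.  As for Coquelicot's [RInt], the total operators
   are the description [iota] applied to the corresponding relation, so they are
   only meaningful when the limit exists. *)

Definition is_Clim_seq (u : nat -> C) (l : C) : Prop :=
  filterlim u eventually (locally (T := C_R_CompleteNormedModule) l).

Definition ex_Clim_seq (u : nat -> C) : Prop := exists l : C, is_Clim_seq u l.

Definition Clim_seq (u : nat -> C) : C :=
  iota (T := C_R_CompleteNormedModule) (is_Clim_seq u).

Definition is_Cseries (a : nat -> C) (l : C) : Prop :=
  is_series (V := C_R_CompleteNormedModule) a l.

Definition ex_Cseries (a : nat -> C) : Prop := exists l : C, is_Cseries a l.

Definition Cseries (a : nat -> C) : C :=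
  iota (T := C_R_CompleteNormedModule) (is_Cseries a).

(* (c;q)_n = (1 - c) (1 - c q) ... (1 - c q^(n-1)) *)
Fixpoint qpoch (c q : C) (n : nat) : C :=
  match n with
  | O => 1
  | S m => qpoch c q m * (1 - c * q ^ m)
  end.

Definition qpoch_inf (c q : C) : C := Clim_seq (qpoch c q).

(* Only used for k <= n: for k > n the truncated n - k makes this a junk value. *)
Definition qbinom (q : C) (n k : nat) : C :=
  qpoch q q n / (qpoch q q k * qpoch q q (n - k)).

Definition ramanujan_term (q z : C) (n : nat) : C :=
  (- z) ^ n / qpoch q q n * q ^ (n ^ 2).

Definition ramanujan_A (q z : C) : C := Cseries (ramanujan_term q z).

(* [sum_n f n] is f 0 + ... + f n, both ends included. *)
Definition stieltjes_wigert (n : nat) (x q : C) : C :=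
  1 / qpoch q q n * sum_n (fun k => qbinom q n k * q ^ (k ^ 2) * (- x) ^ k) n.

(* Main.v *)
Require Import Defs.
From Stdlib Require Import Lra Lia.

(** Write (c)_n for (c;q)_n, A_k for the k-th term of the Ramanujan series at
    w z, and t_n for the n-th term of the series on the right-hand side.

    The identity is the limit N -> oo of an identity between finite sums,

      sum_{k<=N} A_k / (q)_{N-k} = (wq)_N sum_{n<=N} t_n / (q)_{N-n}

    ([ramanujan_stieltjes_wigert_finite]).  To get it, expand each polynomial
    S_n: the power q^(-nk) coming from the argument z q^(-n) combines with
    q^(n^2) so that, with n = k + m, t_n is the sum over k of
    A_k q^(m^2) (w q^k)^m / ((q)_m (wq)_(k+m)).  Exchanging the two sums leaves,
    for each k, a sum over m <= N-k, which is evaluated by the finite form of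
    Cauchy's identity

      sum_{m<=N} [N choose m]_q q^(m^2) a^m / (aq)_m = 1 / (aq)_N

    ([durfee_square_sum]): it classifies the partitions with parts at most N
    by their Durfee square.

    For the limit, multiply by (q)_N.  The weights (q)_N / (q)_{N-n} differ from 1
    by O(q^(N-n)), so the weighted sum of an absolutely convergent series differs
    from its ordinary partial sum by at most a constant times the N-th term of the
    Cauchy product of that series with sum_n q^n.  That product converges, hence
    its terms tend to 0 ([cvg_weighted_sums]).  Working with finite sums on
    both sides means that no infinite double series has to be rearranged.

    Absolute convergence of the right-hand series ([wigert_term_summable]) again
    comes from a Cauchy product: |t_n| is at most a constant times
    sum_{k+m=n} q^(k^2) |wz|^k q^(m^2) |w|^m.  The constant comes
    from uniform bounds on the reciprocals of (q)_n and (wq)_n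
    ([qpoch_inv_bounded]). *)

(** * Finite sums in C *)

(** The same sum as in the definition of the Stieltjes-Wigert polynomials, but
    with codomain C itself, so that [ring] and [field] recognize its values. *)
Definition csum (f : nat -> C) (n : nat) : C := sum_n f n.

Lemma csum_O (f : nat -> C) : csum f 0 = f 0%nat.
Proof. exact (sum_O (G := C_AbelianMonoid) f). Qed.

Lemma csum_S (f : nat -> C) (n : nat) : csum f (S n) = csum f n + f (S n).
Proof. exact (sum_Sn (G := C_AbelianMonoid) f n). Qed.

Lemma csum_ext (f g : nat -> C) (n : nat) :
  (forall k, (k <= n)%nat -> f k = g k) -> csum f n = csum g n.
Proof. exact (sum_n_ext_loc (G := C_AbelianMonoid) f g n). Qed.

Lemma csum_plus (f g : nat -> C) (n : nat) :
  csum (fun k => f k + g k) n = csum f n + csum g n.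
Proof. exact (sum_n_plus (G := C_AbelianMonoid) f g n). Qed.

Lemma csum_mult_l (c : C) (f : nat -> C) (n : nat) :
  csum (fun k => c * f k) n = c * csum f n.
Proof. exact (sum_n_mult_l (K := C_Ring) c f n). Qed.

Lemma csum_split_first (f : nat -> C) (n : nat) :
  csum f (S n) = f 0%nat + csum (fun k => f (S k)) n.
Proof.
  induction n as [|n IH].
  - now rewrite csum_S, !csum_O.
  - rewrite csum_S, IH, csum_S. ring.
Qed.

Lemma csum_triangle (h : nat -> nat -> C) (N : nat) :
  csum (fun n => csum (fun k => h k (n - k)%nat) n) N =
  csum (fun k => csum (fun m => h k m) (N - k)) N.
Proof.
  induction N as [|N IH].
  - now rewrite !csum_O.
  - rewrite csum_S, IH, !csum_S, Nat.sub_diag, csum_O, Cplus_assoc. f_equal.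
    rewrite <- csum_plus. apply csum_ext. intros k Hk.
    now rewrite (Nat.sub_succ_l k N Hk), csum_S.
Qed.

(** * The finite identity *)

Lemma qpoch_split (c q : C) (k m : nat) :
  qpoch c q (k + m) = qpoch c q k * qpoch (c * q ^ k) q m.
Proof.
  induction m as [|m IH].
  - rewrite Nat.add_0_r. cbn. ring.
  - rewrite Nat.add_succ_r. cbn [qpoch]. rewrite IH, Cpow_add_r. ring.
Qed.

Lemma qpoch_S_first (c q : C) (n : nat) :
  qpoch c q (S n) = (1 - c) * qpoch (c * q) q n.
Proof.
  change (S n) with (1 + n)%nat. rewrite qpoch_split. cbn [qpoch].
  rewrite Cpow_1_r. cbn. ring.
Qed.

Lemma qpoch_neq_0 (c q : C) (n : nat) :
  (forall k, c * q ^ k <> 1) -> qpoch c q n <> 0.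
Proof.
  intros H. induction n as [|n IH]; cbn.
  - exact C1_nz.
  - apply Cmult_neq_0; [exact IH|]. apply Cminus_eq_contra. apply not_eq_sym, H.
Qed.

(** The q-Pascal rule [N+1, m] = q^m [N, m] + [N, m-1], summed against X.  It is
    stated through the products (q)_m (q)_(N-m) to avoid binomials out of range:
    write 1 - q^(N+1) as q^m (1 - q^(N+1-m)) + (1 - q^m), where the first part
    vanishes at m = N+1 and the second at m = 0. *)
Lemma csum_q_pascal (q : C) (X : nat -> C) (N : nat) :
  (forall n, qpoch q q n <> 0) ->
  (1 - q * q ^ N) * csum (fun m => X m / (qpoch q q m * qpoch q q (S N - m))) (S N) =
  csum (fun m => (q ^ m * X m + X (S m)) / (qpoch q q m * qpoch q q (N - m))) N.
Proof.
  intros Hq.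
  assert (Hf : forall n, 1 - q * q ^ n <> 0).
  { intros n E. apply (Hq (S n)). cbn. rewrite E. ring. }
  rewrite <- csum_mult_l.
  rewrite (csum_ext _ (fun m =>
     q ^ m * X m * (1 - q ^ (S N - m)) / (qpoch q q m * qpoch q q (S N - m)) +
     X m * (1 - q ^ m) / (qpoch q q m * qpoch q q (S N - m)))).
  2:{ intros m Hm. replace (q * q ^ N) with (q ^ m * q ^ (S N - m)).
      - field. split; apply Hq.
      - rewrite <- Cpow_add_r, <- Cpow_S. f_equal. lia. }
  rewrite csum_plus, csum_S, Nat.sub_diag,
    (csum_split_first (fun m => X m * (1 - q ^ m) / _)).
  rewrite (csum_ext (fun m => (q ^ m * X m + X (S m)) / _) (fun m =>
     q ^ m * X m / (qpoch q q m * qpoch q q (N - m)) +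
     X (S m) / (qpoch q q m * qpoch q q (N - m)))).
  2:{ intros m _. field. split; apply Hq. }
  rewrite csum_plus.
  rewrite (csum_ext _ (fun m => q ^ m * X m / (qpoch q q m * qpoch q q (N - m)))).
  2:{ intros m Hm. rewrite (Nat.sub_succ_l m N Hm). cbn [qpoch]. rewrite Cpow_S.
      field. repeat split; auto. }
  rewrite (csum_ext (fun k => X (S k) * (1 - q ^ S k) / _)
     (fun m => X (S m) / (qpoch q q m * qpoch q q (N - m)))).
  2:{ intros m Hm. cbn [qpoch Nat.sub]. rewrite Cpow_S. field. repeat split; auto. }
  cbn [Cpow]. field. repeat split; auto; apply (Hq 0%nat).
Qed.

(** Induction on N for all a at once: the q-Pascal rule merges the terms m and
    m+1 over the common denominator (aq)_(m+1), and their numerators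
    (1 - a q^(m+1)) + a q^(m+1) add up to 1.  What remains is the sum for N and
    aq, divided by 1 - aq. *)
Lemma durfee_square_sum (q : C) (N : nat) :
  (forall n, qpoch q q n <> 0) ->
  forall a, (forall n, qpoch (a * q) q n <> 0) ->
  csum (fun m => q ^ (m ^ 2) * a ^ m / qpoch (a * q) q m
                 / (qpoch q q m * qpoch q q (N - m))) N =
  1 / (qpoch q q N * qpoch (a * q) q N).
Proof.
  intros Hq.
  assert (Hf : forall n, 1 - q * q ^ n <> 0).
  { intros n E. apply (Hq (S n)). cbn. rewrite E. ring. }
  induction N as [|N IH]; intros a Ha.
  - rewrite csum_O. cbn. field.
  - assert (Ha1 : 1 - a * q <> 0).
    { intros E. apply (Ha 1%nat). rewrite qpoch_S_first, E. ring. }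
    assert (Ha' : forall n, qpoch (a * q * q) q n <> 0).
    { intros n E. apply (Ha (S n)). rewrite qpoch_S_first, E. ring. }
    assert (Haf : forall n, 1 - a * q * q ^ n <> 0).
    { intros n E. apply (Ha (S n)). cbn. rewrite E. ring. }
    assert (E := csum_q_pascal q
      (fun m => q ^ (m ^ 2) * a ^ m / qpoch (a * q) q m) N Hq). cbv beta in E.
    rewrite (csum_ext (fun m => (q ^ m * _ + _) / _) (fun m => / (1 - a * q) *
      (q ^ (m ^ 2) * (a * q) ^ m / qpoch (a * q * q) q m
                 / (qpoch q q m * qpoch q q (N - m))))) in E.
    2:{ intros m _.
        replace (S m ^ 2)%nat with (m ^ 2 + m + m + 1)%nat by (cbn; lia).
        rewrite !Cpow_add_r, Cpow_1_r.
        assert (F : qpoch (a * q) q m * (1 - a * q * q ^ m) =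
                    (1 - a * q) * qpoch (a * q * q) q m)
          by exact (qpoch_S_first (a * q) q m).
        replace (qpoch (a * q * q) q m) with
          (qpoch (a * q) q m * (1 - a * q * q ^ m) / (1 - a * q))
          by (rewrite F; field; exact Ha1).
        cbn [qpoch]. rewrite Cpow_mult_l, Cpow_S. field. repeat split; auto. }
    rewrite csum_mult_l, IH in E by exact Ha'.
    apply (f_equal (fun x => / (1 - q * q ^ N) * x)) in E.
    rewrite Cmult_assoc, Cinv_l, Cmult_1_l in E by apply Hf.
    rewrite E, (qpoch_S_first (a * q)). cbn [qpoch]. field. repeat split; auto.
Qed.

Definition wigert_term (q w z : C) (n : nat) : C :=
  q ^ (n ^ 2) * w ^ n / qpoch (w * q) q n * stieltjes_wigert n (z / q ^ n) q.

(** With n = k + m, the exponent of q is n^2 + k^2 - nk = k^2 + m^2 + km. *)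
Lemma wigert_term_expand (q w z : C) (n : nat) :
  q <> 0 -> (forall n, qpoch q q n <> 0) -> (forall n, qpoch (w * q) q n <> 0) ->
  wigert_term q w z n =
  csum (fun k => ramanujan_term q (w * z) k
     * (q ^ ((n - k) ^ 2) * (w * q ^ k) ^ (n - k))
     / (qpoch q q (n - k) * qpoch (w * q) q n)) n.
Proof.
  intros H0 Hq Hw. unfold wigert_term, stieltjes_wigert.
  fold (csum (fun k => qbinom q n k * q ^ (k ^ 2) * (- (z / q ^ n)) ^ k) n).
  rewrite <- !csum_mult_l. apply csum_ext. intros k Hk.
  unfold qbinom, ramanujan_term.
  destruct (Nat.le_exists_sub k n Hk) as [m [-> _]].
  rewrite Nat.add_sub.
  assert (Hk0 : forall j, q ^ j <> 0) by (intros; now apply Cpow_nz).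
  replace (q ^ ((m + k) ^ 2)) with (q ^ (m ^ 2) * q ^ (k ^ 2) * (q ^ k) ^ m * (q ^ k) ^ m)
    by (rewrite <- !Cpow_mult_r, <- !Cpow_add_r; f_equal; cbn; nia).
  replace (- (z / q ^ (m + k))) with (- z * / q ^ (m + k)) by (field; auto).
  rewrite (Cpow_mult_l (- z)), Cpow_inv by auto.
  replace ((q ^ (m + k)) ^ k) with ((q ^ k) ^ m * q ^ (k ^ 2))
    by (rewrite <- !Cpow_mult_r, <- !Cpow_add_r; f_equal; cbn; nia).
  replace (- (w * z)) with (w * - z) by ring.
  rewrite !Cpow_mult_l, (Cpow_add_r w).
  field. repeat split; auto. now apply Cpow_nz.
Qed.

(** After exchanging the two sums, (wq)_(k+m) = (wq)_k (w q^(k+1))_m turns the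
    inner one into [durfee_square_sum] at a = w q^k. *)
Lemma ramanujan_stieltjes_wigert_finite (q w z : C) (N : nat) :
  q <> 0 -> (forall n, qpoch q q n <> 0) -> (forall n, qpoch (w * q) q n <> 0) ->
  csum (fun k => ramanujan_term q (w * z) k / qpoch q q (N - k)) N =
  qpoch (w * q) q N * csum (fun n => wigert_term q w z n / qpoch q q (N - n)) N.
Proof.
  intros H0 Hq Hw.
  pose (h := fun k m : nat => ramanujan_term q (w * z) k
     * (q ^ (m ^ 2) * (w * q ^ k) ^ m)
     / (qpoch q q m * qpoch (w * q) q (k + m) * qpoch q q (N - (k + m)))).
  rewrite (csum_ext (fun n => wigert_term q w z n / _)
    (fun n => csum (fun k => h k (n - k)%nat) n)).
  2:{ intros n Hn. rewrite wigert_term_expand by auto.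
      unfold Cdiv at 1. rewrite Cmult_comm, <- csum_mult_l. apply csum_ext. intros k Hk.
      unfold h. replace (k + (n - k))%nat with n by lia. field. auto. }
  rewrite csum_triangle, <- csum_mult_l. apply csum_ext. intros k Hk.
  assert (Hs : forall n, qpoch (w * q) q k * qpoch (w * q ^ k * q) q n
               = qpoch (w * q) q (k + n)).
  { intros n. rewrite qpoch_split. do 2 f_equal. ring. }
  assert (Hk' : forall n, qpoch (w * q ^ k * q) q n <> 0).
  { intros n E. apply (Hw (k + n)%nat). rewrite <- Hs, E. ring. }
  unfold h.
  rewrite (csum_ext _ (fun m => ramanujan_term q (w * z) k / qpoch (w * q) q k *
     (q ^ (m ^ 2) * (w * q ^ k) ^ m / qpoch (w * q ^ k * q) q m
                 / (qpoch q q m * qpoch q q (N - k - m))))).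
  2:{ intros m _. rewrite <- Hs, Nat.sub_add_distr. field. repeat split; auto. }
  rewrite csum_mult_l, durfee_square_sum by auto.
  replace (qpoch (w * q) q N) with (qpoch (w * q) q (k + (N - k))) by (f_equal; lia).
  rewrite <- Hs. field. repeat split; auto.
Qed.

(** * Limits and series in C *)

Lemma Cmod_csum_le (f : nat -> C) (b : nat -> R) (n : nat) :
  (forall k, (k <= n)%nat -> Cmod (f k) <= b k)%R ->
  (Cmod (csum f n) <= sum_f_R0 b n)%R.
Proof.
  induction n as [|n IH]; intros H.
  - rewrite csum_O. apply H. lia.
  - rewrite csum_S. cbn [sum_f_R0]. eapply Rle_trans; [apply Cmod_triangle|].
    apply Rplus_le_compat; [apply IH; intros k Hk|]; apply H; lia.
Qed.

Lemma norm_Cmod (x : C) : norm (V := C_R_CompleteNormedModule) x = Cmod x.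
Proof. symmetry. exact (Cmod_norm x). Qed.

Lemma is_Clim_seq_Cmod (u : nat -> C) (l : C) :
  is_Clim_seq u l <-> is_lim_seq (fun n => Cmod (u n - l)) 0.
Proof.
  unfold is_Clim_seq.
  rewrite (filterlim_locally_ball_norm (U := C_R_CompleteNormedModule) u l).
  rewrite <- is_lim_seq_spec.
  assert (E : forall n, Rabs (Cmod (u n - l) - 0) = Cmod (u n - l)).
  { intros n. rewrite Rminus_0_r. apply Rabs_pos_eq, Cmod_ge_0. }
  split; intros H eps; destruct (H eps) as [N HN]; exists N; intros n Hn.
  - rewrite E, <- norm_Cmod. exact (HN n Hn).
  - specialize (HN n Hn). rewrite E, <- norm_Cmod in HN. exact HN.
Qed.

Lemma is_Clim_seq_unique (u : nat -> C) (l1 l2 : C) :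
  is_Clim_seq u l1 -> is_Clim_seq u l2 -> l1 = l2.
Proof.
  apply (filterlim_locally_unique (V := C_R_CompleteNormedModule) (F := eventually)).
Qed.

Lemma is_Clim_seq_mult (u v : nat -> C) (lu lv : C) :
  is_Clim_seq u lu -> is_Clim_seq v lv -> is_Clim_seq (fun n => u n * v n) (lu * lv).
Proof.
  rewrite !is_Clim_seq_Cmod. intros Hu Hv.
  apply (is_lim_seq_le_le (fun _ => 0%R) _ (fun n =>
    Cmod (u n - lu) * Cmod (v n - lv) + Cmod lu * Cmod (v n - lv)
    + Cmod lv * Cmod (u n - lu))%R).
  - intros n. split; [apply Cmod_ge_0|].
    replace (u n * v n - lu * lv) with
      ((u n - lu) * (v n - lv) + lu * (v n - lv) + lv * (u n - lu)) by ring.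
    rewrite <- !Cmod_mult.
    eapply Rle_trans; [apply Cmod_triangle|].
    apply Rplus_le_compat_r, Cmod_triangle.
  - apply is_lim_seq_const.
  - replace (Finite 0) with (Finite (0 * 0 + Cmod lu * 0 + Cmod lv * 0))
      by (f_equal; ring).
    apply is_lim_seq_plus'; [apply is_lim_seq_plus'|].
    + now apply is_lim_seq_mult'.
    + now apply (is_lim_seq_scal_l _ (Cmod lu) (Finite 0)).
    + now apply (is_lim_seq_scal_l _ (Cmod lv) (Finite 0)).
Qed.

Lemma Clim_seq_correct (u : nat -> C) (l : C) : is_Clim_seq u l -> Clim_seq u = l.
Proof.
  apply (iota_filterlim_locally (V := C_R_CompleteNormedModule) (F := eventually)).
Qed.

Lemma Cseries_correct (a : nat -> C) (l : C) : is_Cseries a l -> Cseries a = l.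
Proof.
  apply (iota_filterlim_locally (V := C_R_CompleteNormedModule) (F := eventually)).
Qed.

Lemma ex_Cseries_le (a : nat -> C) (b : nat -> R) :
  (forall n, Cmod (a n) <= b n)%R -> ex_series b -> ex_Cseries a.
Proof.
  intros H. apply (ex_series_le (V := C_R_CompleteNormedModule) a b).
  intros n. rewrite norm_Cmod. apply H.
Qed.

(** * Estimates for q-shifted factorials *)

Section RealBase.

Variable q : R.
Hypotheses (hq0 : (0 < q)%R) (hq1 : (q < 1)%R).

Let hqabs : (Rabs q < 1)%R.
Proof. rewrite Rabs_pos_eq; lra. Qed.

Let hqn (n : nat) : (0 < q ^ n)%R.
Proof. now apply pow_lt. Qed.

Lemma Cmod_qpow (n : nat) : Cmod (RtoC q ^ n) = (q ^ n)%R.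
Proof. now rewrite Cmod_pow, Cmod_R, Rabs_pos_eq by lra. Qed.

Lemma qpow_le_1 (n : nat) : (q ^ n <= 1)%R.
Proof. rewrite <- (pow1 n). apply pow_incr. lra. Qed.

(** Since 1 + x <= exp x, u n is at most u 0 times exp (K (1 + q + q^2 + ...)).
    This bounds both (c)_n and its reciprocal. *)
Lemma bounded_of_geometric_growth (u : nat -> R) (K : R) :
  (0 <= K)%R -> (forall n, 0 <= u n)%R ->
  (forall n, u (S n) <= u n * (1 + K * q ^ n))%R ->
  exists B, forall n, (u n <= B)%R.
Proof.
  intros HK Hu0 Hu. exists (u 0%nat * exp (K / (1 - q)))%R.
  assert (H : forall n, (u n <= u 0%nat * exp (K * (1 - q ^ n) / (1 - q)))%R).
  { induction n as [|n IH].
    - cbn. replace (K * (1 - 1) / (1 - q))%R with 0%R by (field; lra).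
      rewrite exp_0. lra.
    - replace (K * (1 - q ^ S n) / (1 - q))%R with
        (K * (1 - q ^ n) / (1 - q) + K * q ^ n)%R by (cbn; field; lra).
      rewrite exp_plus, <- Rmult_assoc.
      eapply Rle_trans; [apply Hu|].
      assert (0 <= K * q ^ n)%R by (apply Rmult_le_pos; [lra|apply Rlt_le, hqn]).
      apply Rmult_le_compat; [apply Hu0|lra|exact IH|].
      destruct (Req_dec (K * q ^ n) 0) as [->|Hne].
      + rewrite exp_0. lra.
      + apply Rlt_le, exp_ineq1, Hne. }
  intros n. eapply Rle_trans; [apply H|].
  apply Rmult_le_compat_l; [apply Hu0|].
  assert (K * (1 - q ^ n) / (1 - q) <= K / (1 - q))%R.
  { apply Rmult_le_compat_r; [apply Rlt_le, Rinv_0_lt_compat; lra|].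
    rewrite <- (Rmult_1_r K) at 2. apply Rmult_le_compat_l; [lra|].
    specialize (hqn n). lra. }
  destruct (Rle_lt_or_eq_dec _ _ H0) as [H1|H1].
  - apply Rlt_le, exp_increasing, H1.
  - rewrite H1. lra.
Qed.

Lemma qpoch_bounded (c : C) :
  exists B, forall n, (Cmod (qpoch c (RtoC q) n) <= B)%R.
Proof.
  apply (bounded_of_geometric_growth _ (Cmod c)).
  - apply Cmod_ge_0.
  - intros n. apply Cmod_ge_0.
  - intros n. cbn [qpoch]. rewrite Cmod_mult.
    apply Rmult_le_compat_l; [apply Cmod_ge_0|].
    eapply Rle_trans; [apply Cmod_triangle|].
    rewrite Cmod_opp, Cmod_mult, Cmod_qpow, Cmod_1. lra.
Qed.

Lemma bounded_below_of_eventually (v : nat -> R) (d : R) (N : nat) :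
  (forall n, 0 < v n)%R -> (0 < d)%R -> (forall n, (N <= n)%nat -> d <= v n)%R ->
  exists d', (0 < d')%R /\ forall n, (d' <= v n)%R.
Proof.
  intros Hv. revert d. induction N as [|N IH]; intros d Hd H.
  - exists d. split; [exact Hd|]. intros n. apply H. lia.
  - apply (IH (Rmin d (v N))).
    + now apply Rmin_pos.
    + intros n Hn. destruct (Nat.eq_dec n N) as [->|Hne].
      * apply Rmin_r.
      * eapply Rle_trans; [apply Rmin_l|]. apply H. lia.
Qed.

(** The factors are nonzero and tend to 1. *)
Lemma qfactor_bounded_below (c : C) :
  (forall k, c * RtoC q ^ k <> 1) ->
  exists d, (0 < d)%R /\ forall n, (d <= Cmod (1 - c * RtoC q ^ n))%R.
Proof.
  intros Hc.
  assert (Hl : is_lim_seq (fun n => Cmod c * q ^ n)%R 0).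
  { rewrite <- (Rmult_0_r (Cmod c)).
    apply (is_lim_seq_scal_l _ (Cmod c) (Finite 0)), is_lim_seq_geom, hqabs. }
  apply is_lim_seq_spec in Hl.
  destruct (Hl (mkposreal (1 / 2) ltac:(lra))) as [N HN]. cbn in HN.
  apply (bounded_below_of_eventually _ (1 / 2) N); [|lra|].
  - intros n. apply Cmod_gt_0. apply Cminus_eq_contra, not_eq_sym, Hc.
  - intros n Hn. specialize (HN n Hn). apply Rabs_def2 in HN.
    assert (T := Cmod_triangle (1 - c * RtoC q ^ n) (c * RtoC q ^ n)).
    replace (1 - c * RtoC q ^ n + c * RtoC q ^ n) with (RtoC 1) in T by ring.
    rewrite Cmod_1, Cmod_mult, Cmod_qpow in T. lra.
Qed.

(** If d bounds the factors x = |1 - c q^n| from below, then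
    1/x <= 1 + |c| q^n / x <= 1 + (|c|/d) q^n, so the reciprocals satisfy the
    hypothesis of [bounded_of_geometric_growth]. *)
Lemma qpoch_inv_bounded (c : C) :
  (forall k, c * RtoC q ^ k <> 1) ->
  exists B, (0 <= B)%R /\ forall n, (/ Cmod (qpoch c (RtoC q) n) <= B)%R.
Proof.
  intros Hc. destruct (qfactor_bounded_below c Hc) as (d & Hd & Hdn).
  assert (Hp : forall n, (0 < / Cmod (qpoch c (RtoC q) n))%R).
  { intros n. now apply Rinv_0_lt_compat, Cmod_gt_0, qpoch_neq_0. }
  destruct (bounded_of_geometric_growth
    (fun n => / Cmod (qpoch c (RtoC q) n))%R (Cmod c / d)) as [B HB].
  - apply Rmult_le_pos; [apply Cmod_ge_0|]. now apply Rlt_le, Rinv_0_lt_compat.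
  - intros n. apply Rlt_le, Hp.
  - intros n. cbn [qpoch]. rewrite Cmod_mult, Rinv_mult.
    apply Rmult_le_compat_l; [apply Rlt_le, Hp|].
    specialize (Hdn n).
    assert (T := Cmod_triangle (1 - c * RtoC q ^ n) (c * RtoC q ^ n)).
    replace (1 - c * RtoC q ^ n + c * RtoC q ^ n) with (RtoC 1) in T by ring.
    rewrite Cmod_1, Cmod_mult, Cmod_qpow in T.
    set (x := Cmod (1 - _)) in *.
    assert (Hx : (0 < x)%R) by lra.
    apply (Rmult_le_reg_l x); [exact Hx|]. rewrite Rinv_r by lra.
    assert (0 <= Cmod c * q ^ n)%R
      by (apply Rmult_le_pos; [apply Cmod_ge_0|apply Rlt_le, hqn]).
    replace (x * (1 + Cmod c / d * q ^ n))%R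
      with (x + (Cmod c * q ^ n) * (x / d))%R by (field; lra).
    assert (1 <= x / d)%R.
    { apply (Rmult_le_reg_r d); [lra|]. unfold Rdiv.
      rewrite Rmult_assoc, Rinv_l; lra. }
    assert (Cmod c * q ^ n * 1 <= Cmod c * q ^ n * (x / d))%R
      by (apply Rmult_le_compat_l; lra).
    lra.
  - exists B. split; [|exact HB]. specialize (HB 0%nat). specialize (Hp 0%nat). lra.
Qed.

(** The increments of (c)_n are -(c)_n c q^n, with (c)_n bounded: sum a geometric
    progression. *)
Lemma qpoch_cauchy (c : C) :
  exists K, (0 <= K)%R /\ forall M j,
    (Cmod (qpoch c (RtoC q) (M + j) - qpoch c (RtoC q) M) <= K * q ^ M)%R.
Proof.
  destruct (qpoch_bounded c) as [B HB].
  assert (HB0 : (0 <= B)%R) by (eapply Rle_trans; [apply Cmod_ge_0|apply (HB 0%nat)]).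
  assert (HBc : (0 <= B * Cmod c / (1 - q))%R).
  { apply Rmult_le_pos; [apply Rmult_le_pos; [exact HB0|apply Cmod_ge_0]|].
    apply Rlt_le, Rinv_0_lt_compat. lra. }
  exists (B * Cmod c / (1 - q))%R. split; [exact HBc|]. intros M j.
  apply Rle_trans with (B * Cmod c / (1 - q) * (q ^ M - q ^ (M + j)))%R.
  - induction j as [|j IH].
    + rewrite Nat.add_0_r. unfold Cminus. rewrite Cplus_opp_r, Cmod_0. lra.
    + rewrite Nat.add_succ_r. cbn [qpoch].
      set (P := qpoch c (RtoC q)) in *.
      replace (P (M + j)%nat * (1 - c * RtoC q ^ (M + j)) - P M) with
        ((P (M + j)%nat - P M) + - (P (M + j)%nat * (c * RtoC q ^ (M + j)))) by ring.
      eapply Rle_trans; [apply Cmod_triangle|].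
      rewrite Cmod_opp, !Cmod_mult, Cmod_qpow.
      replace (B * Cmod c / (1 - q) * (q ^ M - q ^ S (M + j)))%R with
        (B * Cmod c / (1 - q) * (q ^ M - q ^ (M + j)) + B * (Cmod c * q ^ (M + j)))%R
        by (cbn; field; lra).
      apply Rplus_le_compat; [exact IH|].
      apply Rmult_le_compat_r; [|apply HB].
      apply Rmult_le_pos; [apply Cmod_ge_0|apply Rlt_le, hqn].
  - apply Rmult_le_compat_l; [exact HBc|]. specialize (hqn (M + j)). lra.
Qed.

Lemma ex_Clim_qpoch (c : C) : ex_Clim_seq (qpoch c (RtoC q)).
Proof.
  destruct (qpoch_cauchy c) as (K & HK & H).
  apply (filterlim_locally_cauchy (U := C_R_CompleteNormedModule) (F := eventually)).
  intros eps.
  assert (Hl : is_lim_seq (fun n => K * q ^ n)%R 0).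
  { rewrite <- (Rmult_0_r K).
    apply (is_lim_seq_scal_l _ K (Finite 0)), is_lim_seq_geom, hqabs. }
  apply is_lim_seq_spec in Hl.
  destruct (Hl (pos_div_2 eps)) as [N HN].
  exists (fun n => (N <= n)%nat). split.
  - exists N. auto.
  - assert (HNN : forall n, (N <= n)%nat ->
      (Cmod (qpoch c (RtoC q) n - qpoch c (RtoC q) N) < eps / 2)%R).
    { intros n Hn. replace n with (N + (n - N))%nat by lia.
      eapply Rle_lt_trans; [apply H|].
      specialize (HN N (le_n N)). apply Rabs_def2 in HN. cbn in HN. lra. }
    intros m n Hm Hn.
    apply (norm_compat1 (V := C_R_CompleteNormedModule)).
    rewrite norm_Cmod.
    change (Cmod (qpoch c (RtoC q) n - qpoch c (RtoC q) m) < eps)%R.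
    replace (qpoch c (RtoC q) n - qpoch c (RtoC q) m) with
      ((qpoch c (RtoC q) n - qpoch c (RtoC q) N)
       + - (qpoch c (RtoC q) m - qpoch c (RtoC q) N)) by ring.
    eapply Rle_lt_trans; [apply Cmod_triangle|]. rewrite Cmod_opp.
    specialize (HNN m Hm) as H1. specialize (HNN n Hn) as H2. lra.
Qed.

(** * Absolute convergence and passage to the limit *)

(** The ratio test is applied at x + 1, so that no term vanishes. *)
Lemma theta_series_summable (x : R) :
  (0 <= x)%R -> ex_series (fun n => q ^ (n ^ 2) * x ^ n)%R.
Proof.
  intros Hx.
  assert (Hp : forall n, (0 < q ^ (n ^ 2) * (x + 1) ^ n)%R).
  { intros n. apply Rmult_lt_0_compat; [apply hqn|apply pow_lt; lra]. }
  apply (ex_series_le (V := R_CompleteNormedModule) _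
    (fun n => Rabs (q ^ (n ^ 2) * (x + 1) ^ n))).
  - intros n. change (norm ?t) with (Rabs t).
    rewrite !Rabs_mult. apply Rmult_le_compat_l; [apply Rabs_pos|].
    rewrite !Rabs_pos_eq by (apply pow_le; lra). apply pow_incr. lra.
  - apply (ex_series_DAlembert _ 0); [lra| |].
    + intros n E. specialize (Hp n). lra.
    + apply (is_lim_seq_ext (fun n => (q * (x + 1)) * (q ^ n * q ^ n))%R).
      * intros n. rewrite Rabs_pos_eq.
        2:{ apply Rlt_le, Rmult_lt_0_compat; [apply Hp|apply Rinv_0_lt_compat, Hp]. }
        replace (S n ^ 2)%nat with (n ^ 2 + n + n + 1)%nat by (cbn; lia).
        rewrite !pow_add. rewrite pow_1. rewrite <- tech_pow_Rmult.
        specialize (hqn (n ^ 2)). assert (0 < (x + 1) ^ n)%R by (apply pow_lt; lra).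
        field. lra.
      * replace (Finite 0) with (Finite (q * (x + 1) * (0 * 0))) by (f_equal; ring).
        apply (is_lim_seq_scal_l _ (q * (x + 1)) (Finite (0 * 0))).
        apply is_lim_seq_mult'; apply is_lim_seq_geom, hqabs.
Qed.

Lemma convolution_summable (a b : nat -> R) :
  (forall n, 0 <= a n)%R -> (forall n, 0 <= b n)%R ->
  ex_series a -> ex_series b ->
  ex_series (fun n => sum_f_R0 (fun k => a k * b (n - k)%nat)%R n).
Proof.
  intros Ha Hb [la Hla] [lb Hlb]. exists (la * lb)%R.
  apply is_series_mult; auto.
  - apply (ex_series_ext a); [|now exists la].
    intros n. symmetry. apply Rabs_pos_eq, Ha.
  - apply (ex_series_ext b); [|now exists lb].
    intros n. symmetry. apply Rabs_pos_eq, Hb.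
Qed.

(** A dominated convergence statement with explicit rate; it is applied to
    u n = (q)_n.  The bounds on u give |u N / u (N-n) - 1| <= K B q^(N-n), so the
    error is at most K B times a term of the Cauchy product of sum_n |a n| and
    sum_n q^n. *)
Lemma cvg_weighted_sums (u a : nat -> C) (l : C) (K B : R) :
  (0 <= K)%R -> (0 <= B)%R ->
  (forall n, u n <> 0) -> (forall n, / Cmod (u n) <= B)%R ->
  (forall M j, Cmod (u (M + j)%nat - u M) <= K * q ^ M)%R ->
  ex_series (fun n => Cmod (a n)) -> is_Cseries a l ->
  is_Clim_seq (fun N => u N * csum (fun n => a n / u (N - n)%nat) N) l.
Proof.
  intros HK HB Hu HuB Huc Ha Hl. apply is_Clim_seq_Cmod.
  apply (is_lim_seq_le_le (fun _ => 0%R) _ (fun N =>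
    (K * B) * sum_f_R0 (fun n => Cmod (a n) * q ^ (N - n)) N + Cmod (csum a N - l))%R).
  - intros N. split; [apply Cmod_ge_0|].
    replace (u N * csum (fun n => a n / u (N - n)%nat) N - l) with
      (csum (fun n => (u N - u (N - n)%nat) * / u (N - n)%nat * a n) N + (csum a N - l)).
    2:{ rewrite <- csum_mult_l.
        rewrite (csum_ext (fun n => u N * (a n / _))
          (fun n => (u N - u (N - n)%nat) * / u (N - n)%nat * a n + a n)).
        - rewrite csum_plus. ring.
        - intros n _. field. apply Hu. }
    eapply Rle_trans; [apply Cmod_triangle|]. apply Rplus_le_compat_r.
    rewrite scal_sum. apply Cmod_csum_le. intros n Hn.
    rewrite !Cmod_mult, Cmod_inv by apply Hu.
    replace (Cmod (a n) * q ^ (N - n) * (K * B))%R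
      with (K * q ^ (N - n) * B * Cmod (a n))%R by ring.
    apply Rmult_le_compat_r; [apply Cmod_ge_0|].
    apply Rmult_le_compat; [apply Cmod_ge_0| | |apply HuB].
    + now apply Rlt_le, Rinv_0_lt_compat, Cmod_gt_0.
    + replace N with ((N - n) + n)%nat at 1 by lia. apply Huc.
  - apply is_lim_seq_const.
  - replace (Finite 0) with (Finite (K * B * 0 + 0)) by (f_equal; ring).
    apply is_lim_seq_plus'.
    + apply (is_lim_seq_scal_l _ (K * B) (Finite 0)), ex_series_lim_0.
      apply (convolution_summable (fun n => Cmod (a n)) (fun n => q ^ n)%R).
      * intros n. apply Cmod_ge_0.
      * intros n. apply Rlt_le, hqn.
      * exact Ha.
      * eexists. apply is_series_geom, hqabs.
    + apply is_Clim_seq_Cmod. exact Hl.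
Qed.

Lemma q_not_unity (k : nat) : RtoC q * RtoC q ^ k <> 1.
Proof.
  rewrite <- Cpow_S, <- RtoC_pow. intros E. apply RtoC_inj in E.
  cbn in E. assert (H := qpow_le_1 k). specialize (hqn k). nra.
Qed.

Lemma ramanujan_term_bound (x : C) :
  exists B, (0 <= B)%R /\ forall n,
    (Cmod (ramanujan_term (RtoC q) x n) <= B * (q ^ (n ^ 2) * Cmod x ^ n))%R.
Proof.
  destruct (qpoch_inv_bounded (RtoC q) q_not_unity) as (B & HB & H).
  exists B. split; [exact HB|]. intros n. unfold ramanujan_term.
  rewrite Cmod_mult, Cmod_div, Cmod_qpow, Cmod_pow, Cmod_opp
    by (apply qpoch_neq_0, q_not_unity).
  unfold Rdiv.
  replace (Cmod x ^ n * / Cmod (qpoch (RtoC q) (RtoC q) n) * q ^ (n ^ 2))%R with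
    (/ Cmod (qpoch (RtoC q) (RtoC q) n) * (q ^ (n ^ 2) * Cmod x ^ n))%R by ring.
  apply Rmult_le_compat_r; [|apply H].
  apply Rmult_le_pos; [apply Rlt_le, hqn|apply pow_le, Cmod_ge_0].
Qed.

Lemma ramanujan_term_summable (x : C) :
  ex_series (fun n => Cmod (ramanujan_term (RtoC q) x n)).
Proof.
  destruct (ramanujan_term_bound x) as (B & HB & H).
  apply (ex_series_le (V := R_CompleteNormedModule) _
    (fun n => B * (q ^ (n ^ 2) * Cmod x ^ n))%R).
  - intros n. change (norm ?t) with (Rabs t).
    rewrite Rabs_pos_eq by apply Cmod_ge_0. apply H.
  - apply (ex_series_scal (K := R_AbsRing) (V := R_NormedModule) B), theta_series_summable, Cmod_ge_0.
Qed.

(** In [wigert_term_expand], bound the reciprocal factorials by constants and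
    |w q^k| by |w|: what remains is the Cauchy product of two theta series. *)
Lemma wigert_term_summable (w z : C) :
  (forall k, w * RtoC q * RtoC q ^ k <> 1) ->
  ex_series (fun n => Cmod (wigert_term (RtoC q) w z n)).
Proof.
  intros Hw.
  destruct (ramanujan_term_bound (w * z)) as (BA & HBA & HA).
  destruct (qpoch_inv_bounded (RtoC q) q_not_unity) as (Bq & HBq & Hq).
  destruct (qpoch_inv_bounded (w * RtoC q) Hw) as (Bw & HBw & Hwn).
  assert (Hg : forall (x : C) n, (0 <= q ^ (n ^ 2) * Cmod x ^ n)%R).
  { intros x n. apply Rmult_le_pos; [apply Rlt_le, hqn|apply pow_le, Cmod_ge_0]. }
  apply (ex_series_le (V := R_CompleteNormedModule) _
    (fun n => (BA * Bq * Bw) * sum_f_R0 (fun k =>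
       (q ^ (k ^ 2) * Cmod (w * z) ^ k) * (q ^ ((n - k) ^ 2) * Cmod w ^ (n - k))) n)%R).
  - intros n. change (norm ?t) with (Rabs t).
    rewrite Rabs_pos_eq by apply Cmod_ge_0.
    rewrite wigert_term_expand.
    2:{ intros E. apply RtoC_inj in E. lra. }
    2:{ intros m. apply qpoch_neq_0, q_not_unity. }
    2:{ intros m. apply qpoch_neq_0, Hw. }
    rewrite scal_sum. apply Cmod_csum_le. intros k Hk.
    assert (Hq0 := qpoch_neq_0 _ _ (n - k) q_not_unity).
    assert (Hw0 := qpoch_neq_0 _ _ n Hw).
    unfold Cdiv.
    rewrite !Cmod_mult, Cmod_inv, Cmod_mult, Rinv_mult
      by now apply Cmult_neq_0.
    rewrite Cmod_qpow, (Cmod_pow (w * _)), (Cmod_mult w), Cmod_qpow.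
    apply Rle_trans with ((BA * (q ^ (k ^ 2) * Cmod (w * z) ^ k))
      * (q ^ ((n - k) ^ 2) * Cmod w ^ (n - k)) * (Bq * Bw))%R.
    2:{ rewrite Cmod_mult. apply Req_le. ring. }
    apply Rmult_le_compat.
    + repeat apply Rmult_le_pos; try apply Cmod_ge_0; try apply Rlt_le, hqn.
      apply pow_le, Rmult_le_pos; [apply Cmod_ge_0|apply Rlt_le, hqn].
    + apply Rmult_le_pos; now apply Rlt_le, Rinv_0_lt_compat, Cmod_gt_0.
    + apply Rmult_le_compat; [apply Cmod_ge_0| |apply HA|].
      * apply Rmult_le_pos; [apply Rlt_le, hqn|].
        apply pow_le, Rmult_le_pos; [apply Cmod_ge_0|apply Rlt_le, hqn].
      * apply Rmult_le_compat_l; [apply Rlt_le, hqn|].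
        apply pow_incr. split.
        -- apply Rmult_le_pos; [apply Cmod_ge_0|apply Rlt_le, hqn].
        -- rewrite <- (Rmult_1_r (Cmod w)) at 2.
           apply Rmult_le_compat_l; [apply Cmod_ge_0|apply qpow_le_1].
    + apply Rmult_le_compat; [| |apply Hq|apply Hwn];
        now apply Rlt_le, Rinv_0_lt_compat, Cmod_gt_0.
  - apply (ex_series_scal (K := R_AbsRing) (V := R_NormedModule) (BA * Bq * Bw)%R).
    apply (convolution_summable (fun k => q ^ (k ^ 2) * Cmod (w * z) ^ k)%R
      (fun m => q ^ (m ^ 2) * Cmod w ^ m)%R); try apply Hg;
      apply theta_series_summable, Cmod_ge_0.
Qed.

End RealBase.

Theorem mainTheorem8 (q : R) (hq0 : (0 < q)%R) (hq1 : (q < 1)%R) (w z : C)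
    (hw : forall k : nat, (1 <= k)%nat -> w * RtoC q ^ k <> 1) :
  let rhs_term (n : nat) : C :=
    RtoC q ^ (n ^ 2) * w ^ n / qpoch (w * RtoC q) (RtoC q) n
      * stieltjes_wigert n (z / RtoC q ^ n) (RtoC q) in
  ex_Cseries (ramanujan_term (RtoC q) (w * z)) /\
  ex_Clim_seq (qpoch (w * RtoC q) (RtoC q)) /\
  ex_Cseries rhs_term /\
  ramanujan_A (RtoC q) (w * z) =
    qpoch_inf (w * RtoC q) (RtoC q) * Cseries rhs_term.
Proof.
  intros t. change t with (wigert_term (RtoC q) w z). clear t.
  assert (Hw : forall k, w * RtoC q * RtoC q ^ k <> 1).
  { intros k. rewrite <- Cmult_assoc, <- Cpow_S. apply hw. lia. }
  assert (Hq := q_not_unity q hq0 hq1).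
  assert (HA := ramanujan_term_summable q hq0 hq1 (w * z)).
  assert (Ht := wigert_term_summable q hq0 hq1 w z Hw).
  assert (EA : ex_Cseries (ramanujan_term (RtoC q) (w * z)))
    by (eapply ex_Cseries_le; [intros n; apply Rle_refl|exact HA]).
  assert (Et : ex_Cseries (wigert_term (RtoC q) w z))
    by (eapply ex_Cseries_le; [intros n; apply Rle_refl|exact Ht]).
  assert (EL := ex_Clim_qpoch q hq0 hq1 (w * RtoC q)).
  repeat split; [exact EA|exact EL|exact Et|].
  destruct EA as [A EA], Et as [T Et], EL as [L EL].
  unfold ramanujan_A, qpoch_inf.
  rewrite (Cseries_correct _ _ EA), (Cseries_correct _ _ Et), (Clim_seq_correct _ _ EL).
  destruct (qpoch_inv_bounded q hq0 hq1 (RtoC q) Hq) as (B & HB & HBn).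
  destruct (qpoch_cauchy q hq0 hq1 (RtoC q)) as (K & HK & HKn).
  assert (Hq' := fun n => qpoch_neq_0 (RtoC q) (RtoC q) n Hq).
  assert (Hw' := fun n => qpoch_neq_0 (w * RtoC q) (RtoC q) n Hw).
  assert (LA := cvg_weighted_sums q hq0 hq1 _ _ A K B HK HB Hq' HBn HKn HA EA).
  assert (Lt := cvg_weighted_sums q hq0 hq1 _ _ T K B HK HB Hq' HBn HKn Ht Et).
  apply (is_Clim_seq_unique _ _ _ LA).
  apply (filterlim_ext (fun N => qpoch (w * RtoC q) (RtoC q) N *
    (qpoch (RtoC q) (RtoC q) N *
     csum (fun n => wigert_term (RtoC q) w z n / qpoch (RtoC q) (RtoC q) (N - n)) N))).
  - intros N. rewrite ramanujan_stieltjes_wigert_finite; auto.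
    + ring.
    + intros E. apply RtoC_inj in E. lra.
  - now apply is_Clim_seq_mult.
Qed.
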